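(* Let $q\equiv 3\pmod 4$ be a prime power. A map $\psi:\mathbb{F}_q^4\to\mathbb{F}_q^4$ satisfies, for all $\mathbf{r}_1,\mathbf{r}_2\in\mathbb{F}_q^4$, $$(\mathbf{r}_1-\mathbf{r}_2,\mathbf{r}_1-\mathbf{r}_2)=0,\ \mathbf{r}_1\neq\mathbf{r}_2\ \Longrightarrow\ \big(\psi(\mathbf{r}_1)-\psi(\mathbf{r}_2),\psi(\mathbf{r}_1)-\psi(\mathbf{r}_2)\big)=0,\ \psi(\mathbf{r}_1)\neq\psi(\mathbf{r}_2),$$ if and only if it is of the form $\psi(\mathbf{r})=\alpha L\mathbf{r}^\tau+\mathbf{r}_0$ for all $\mathbf{r}$, or $\psi(\mathbf{r})=\alpha K\mathbf{r}^\tau+\mathbf{r}_0$ for all $\mathbf{r}$, where $0\neq\alpha\in\mathbb{F}_q$ and $\mathbf{r}_0\in\mathbb{F}_q^4$ are fixed, $\tau$ is an automorphism of $\mathbb{F}_q$ applied coordinate-wise, and $L$ and $K$ are a Lorentz and an anti-Lorentz matrix respectively.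
   Context: For $\mathbf{r}_k=(x_k,y_k,z_k,t_k)^\top\in\mathbb{F}_q^4$ put $(\mathbf{r}_1,\mathbf{r}_2)=-x_1x_2-y_1y_2-z_1z_2+t_1t_2$. A $4\times4$ matrix $L$ over $\mathbb{F}_q$ is Lorentz if $(L\mathbf{r}_1,L\mathbf{r}_2)=(\mathbf{r}_1,\mathbf{r}_2)$ for all $\mathbf{r}_1,\mathbf{r}_2\in\mathbb{F}_q^4$, and anti-Lorentz if $(K\mathbf{r}_1,K\mathbf{r}_2)=-(\mathbf{r}_1,\mathbf{r}_2)$ for all $\mathbf{r}_1,\mathbf{r}_2$. *)

(* Defs.v *)
From HB Require Import structures.
From mathcomp Require Import all_boot all_order all_algebra all_field.
Set Implicit Arguments. Unset Strict Implicit. Unset Printing Implicit Defensive.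
Import GRing.Theory.
Local Open Scope ring_scope.

(* Points of F_q^4 are column vectors r = (x, y, z, t)^T, indices 0,1,2,3. *)
Definition mink (F : fieldType) (r1 r2 : 'cV[F]_4) : F :=
  \sum_(i < 4) (if (i : nat) == 3%N then 1 else -1) * r1 i 0 * r2 i 0.

Definition lorentz (F : fieldType) (L : 'M[F]_4) : Prop :=
  forall r1 r2 : 'cV[F]_4, mink (L *m r1) (L *m r2) = mink r1 r2.

Definition antilorentz (F : fieldType) (K : 'M[F]_4) : Prop :=
  forall r1 r2 : 'cV[F]_4, mink (K *m r1) (K *m r2) = - mink r1 r2.

(* Main.v *)
Require Import Defs.
From HB Require Import structures.
From mathcomp Require Import all_boot all_order all_algebra all_field.
From mathcomp Require Import ring zify.
Set Implicit Arguments. Unset Strict Implicit. Unset Printing Implicit Defensive.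
Import GRing.Theory.
Local Open Scope ring_scope.

(** Since -1 is not a square, the form has Witt index 1: orthogonal null vectors
    are proportional, and [psi] maps null lines bijectively onto null lines.
    Two parallel null lines that differ by a null vector are perfectly matched
    by null vectors, whereas two null lines of different directions have no
    perfect matching; hence [psi] induces a map on null directions.

    That map is injective.  Otherwise the image of a plane spanned by two null
    vectors u, v collapses to a single direction d.  If [psi] moved along some
    non-null y in the plane, then every null vector not orthogonal to y would be
    mapped to the direction d as well; these generate the space, so [psi] would
    be a proper coloring of the nullity graph with q colours, which a
    second-moment count between the slices t - x = 0 and t - x = 1 excludes.
    So [psi] is constant along u + v and u - v, hence along 2 u: absurd.

    For null u, v of different directions, the displacement of [psi] along v is
    then unchanged under translation by u.  As the null vectors not orthogonal
    to v generate the space, [psi] is additive up to translation.  An additive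
    null-preserving map [phi] satisfies
    [2 (phi (a ea), phi (b eb)) = - (phi z, phi z)] whenever z is orthogonal to
    the hyperbolic pair ea, eb and a ea + b eb + z is null; so this value
    depends on the product a b alone, and the field automorphism appears. *)

Section CardMod4.
Variables (F : finFieldType) (card_mod4 : (#|F| %% 4 = 3)%N).

Let cardE : #|F| = (#|F| %/ 4 * 4 + 3)%N.
Proof. by rewrite {1}(divn_eq #|F| 4) card_mod4. Qed.

Lemma finField_sqr_neqN1 (i : F) : i ^+ 2 != -1.
Proof.
have two_neq0 : 2 != 0 :> F.
  apply/negP=> pchar2; have := @card_pprimeChar 2 F pchar2.
  rewrite -[#|_|]/#|F|; case: (logn 2 _) => [|n]; first by rewrite cardE; lia.
  by rewrite expnS; lia.
apply: contra two_neq0 => /eqP i2.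
have : i ^+ 3 = i.
  rewrite -[RHS]expf_card cardE exprD mulnC !exprM (exprM i 2 2).
  by rewrite i2 sqrrN !expr1n mul1r.
rewrite exprS i2 mulrN1 => /eqP; rewrite -subr_eq0 -opprD oppr_eq0 -mulr2n.
rewrite -[i *+ 2]mulr_natl mulf_eq0 => /orP[-> //|/eqP i0].
by move/eqP: i2; rewrite i0 expr0n eq_sym oppr_eq0 oner_eq0.
Qed.

Lemma finField_sqr_or_Nsqr (c : F) : exists s : F, c = s ^+ 2 \/ c = - s ^+ 2.
Proof.
have [->|c_neq0] := eqVneq c 0; first by exists 0; left; rewrite expr0n.
pose m := (#|F| %/ 4)%N; exists (c ^+ m.+1).
have -> : (c ^+ m.+1) ^+ 2 = c * c ^+ (m * 2).+1.
  by rewrite -exprM -exprS; congr (_ ^+ _); lia.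
have : (c ^+ (m * 2).+1) ^+ 2 = 1.
  apply: (mulIf c_neq0); rewrite -exprM -exprSr mul1r -[RHS]expf_card cardE.
  by congr (_ ^+ _); rewrite /m; lia.
by move/eqP; rewrite sqrf_eq1 => /orP[]/eqP->; [left|right]; ring.
Qed.

End CardMod4.

Lemma finField_card_gt2 (F : finFieldType) : 2 != 0 :> F -> (2 < #|F|)%N.
Proof.
move=> two_neq0; have <- : #|[:: 0; 1; -1 : F]| = 3%N; last exact: max_card.
apply/card_uniqP; rewrite /= !inE negb_or eq_sym oner_eq0 eq_sym oppr_eq0.
by rewrite oner_eq0 -subr_eq0 opprK two_neq0.
Qed.

Lemma injective_mul_not_const (F : finFieldType) (f g : F -> F) (k : F) :
  (2 < #|F|)%N -> injective f -> injective g -> exists s, f s * g s != k.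
Proof.
move=> F_gt2 f_inj g_inj.
have [[f' _ f'K] [g' _ g'K]] := (injF_bij f_inj, injF_bij g_inj).
have [k0|k_neq0] := eqVneq k 0; last first.
  by exists (f' 0); rewrite f'K mul0r eq_sym.
have /subsetPn[s _] : ~~ ([set: F] \subset [set f' 0; g' 0]).
  apply/negP=> /subset_leq_card; rewrite leqNgt cardsT.
  by rewrite (leq_trans _ F_gt2) // cards2; case: eqP.
rewrite !inE negb_or k0 => /andP[sf sg]; exists s; rewrite mulf_neq0 //.
  by apply: contra sf => /eqP fs; apply/eqP/f_inj; rewrite fs f'K.
by apply: contra sg => /eqP gs; apply/eqP/g_inj; rewrite gs g'K.
Qed.

Section Collisions.
Variables P B : finType.
Implicit Types f : P -> B.

Lemma sum_card_fiber f : (\sum_b #|[set p | f p == b]| = #|P|)%N.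
Proof.
rewrite -sum1_card (partition_big f xpredT) //=.
by apply: eq_bigr => b _; rewrite sum1_card cardsE.
Qed.

Lemma sum_card_fiber_sqr f :
  (\sum_b #|[set p | f p == b]| ^ 2 = \sum_p #|[set p' | f p' == f p]|)%N.
Proof.
rewrite [RHS](partition_big f xpredT) //=; apply: eq_bigr => b _.
under [RHS]eq_bigr => p /eqP-> do [].
by rewrite sum_nat_const cardsE mulnn.
Qed.

Lemma collisions_of_missed_value f b : (forall p, f p != b) ->
  (#|B|.+1 * #|P| ^ 2 <= #|B| ^ 2 * \sum_p #|[set p' | f p' == f p]|)%N.
Proof.
move=> fb; rewrite -sum_card_fiber_sqr.
have fiber_b : #|[set p | f p == b]| = 0%N.
  by apply: eq_card0 => p; rewrite inE (negPf (fb p)).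
have sum_other : (\sum_(c | c != b) #|[set p | f p == c]| = #|P|)%N.
  by rewrite -(sum_card_fiber f) [RHS](bigD1 b) //= fiber_b.
rewrite [X in (_ <= _ * X)%N](bigD1 b) //= fiber_b add0n.
have : (\sum_(c | c != b) 2 * (#|B| * #|[set p | f p == c]| * #|P|)
    <= \sum_(c | c != b) ((#|B| * #|[set p | f p == c]|) ^ 2 + #|P| ^ 2))%N.
  by apply: leq_sum => c _; exact: nat_Cauchy.
rewrite -big_distrr -big_distrl -big_distrr /= sum_other.
rewrite big_split sum_nat_cond_const cardsE cardC1 /=.
under [X in (_ <= X + _)%N]eq_bigr do rewrite expnMn.
rewrite -big_distrr /=.
have : (0 < #|B|)%N by apply/card_gt0P; exists b.
case: #|B| => // n _ /=; rewrite -mulnA mulnn; move: (_ ^ 2 * _)%N => S; nia.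
Qed.

End Collisions.

Section UniversalFamily.
Variables (P Y B : finType) (h : P -> Y -> B).
Hypothesis h_universal :
  forall p p', p' != p -> (#|B| * #|[set y | h p' y == h p y]| = #|Y|)%N.

Lemma universal_family_collisions p :
  (#|B| * \sum_y #|[set p' | h p' y == h p y]| =
   #|B| * #|Y| + #|P|.-1 * #|Y|)%N.
Proof.
under eq_bigr do rewrite -sum1dep_card big_mkcond /=.
rewrite exchange_big (bigD1 p) //= mulnDr; congr (_ + _)%N.
  by under eq_bigr do rewrite eqxx; rewrite sum1_card.
rewrite big_distrr -(cardC1 p) -sum_nat_const /=.
by apply: eq_bigr => p' /h_universal <-; rewrite -big_mkcond sum1dep_card.
Qed.

(* If [h p y] never met [g y], the maps [h^~ y] would all miss a value and so
   have more collisions than a universal family has on average. *)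
Lemma universal_family_meets_section (g : Y -> B) :
    (0 < #|Y|)%N -> (#|B| ^ 2 < #|P| + #|B|)%N ->
  exists p y, h p y = g y.
Proof.
move=> Y_gt0 P_large.
have [/existsP[p /existsP[y /eqP]]|/existsPn miss] :=
  boolP [exists p, exists y, h p y == g y]; first by exists p, y.
have {}miss y p : h p y != g y by have /existsPn := miss p; apply.
have : (#|Y| * (#|B|.+1 * #|P| ^ 2) <=
        \sum_y #|B| ^ 2 * \sum_p #|[set p' | h p' y == h p y]|)%N.
  rewrite -sum_nat_const; apply: leq_sum => y _.
  exact: collisions_of_missed_value (miss y).
rewrite -big_distrr exchange_big /=.
have -> : (#|B| ^ 2 * \sum_p \sum_y #|[set p' | h p' y == h p y]| =
    #|B| * (#|P| * (#|B| * #|Y| + #|P|.-1 * #|Y|)))%N.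
  rewrite -mulnn -mulnA big_distrr; congr (_ * _)%N => /=.
  under eq_bigr do rewrite universal_family_collisions.
  by rewrite sum_nat_const.
have [y0 _] := card_gt0P Y_gt0.
have B_gt0 : (0 < #|B|)%N by apply/card_gt0P; exists (g y0).
rewrite leqNgt => /negP[].
move: #|B| #|P| #|Y| B_gt0 Y_gt0 P_large => q [|n] m q_gt0 m_gt0; first by nia.
move=> /= n_large.
have -> : (q * (n.+1 * (q * m + n * m)) = m * n.+1 * (q * (q + n)))%N by ring.
have -> : (m * (q.+1 * n.+1 ^ 2) = m * n.+1 * (q.+1 * n.+1))%N by ring.
by rewrite ltn_pmul2l ?muln_gt0 ?m_gt0 //; nia.
Qed.

End UniversalFamily.

Definition null (F : fieldType) (u : 'cV[F]_4) : Prop := mink u u = 0.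

Section MinkowskiForm.
Variable F : fieldType.
Implicit Types (x y z u v w : 'cV[F]_4) (a b c : F).

Lemma minkC x y : mink x y = mink y x.
Proof. by apply: eq_bigr => i _; ring. Qed.

Lemma minkDl x y z : mink (x + y) z = mink x z + mink y z.
Proof. by rewrite -big_split; apply: eq_bigr => i _; rewrite mxE /=; ring. Qed.

Lemma minkZl c x y : mink (c *: x) y = c * mink x y.
Proof. by rewrite mulr_sumr; apply: eq_bigr => i _; rewrite mxE; ring. Qed.

Lemma minkDr x y z : mink z (x + y) = mink z x + mink z y.
Proof. by rewrite !(minkC z) minkDl. Qed.

Lemma minkZr c x y : mink x (c *: y) = c * mink x y.
Proof. by rewrite minkC minkZl minkC. Qed.

Lemma minkNl x y : mink (- x) y = - mink x y.
Proof. by rewrite -scaleN1r minkZl mulN1r. Qed.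

Lemma minkNr x y : mink x (- y) = - mink x y.
Proof. by rewrite minkC minkNl minkC. Qed.

Lemma mink0l x : mink 0 x = 0.
Proof. by rewrite -(scale0r x) minkZl mul0r. Qed.

Lemma mink0r x : mink x 0 = 0.
Proof. by rewrite minkC mink0l. Qed.

Definition mink_bilinear :=
  (minkDl, minkDr, minkZl, minkZr, minkNl, minkNr, mink0l, mink0r).

Lemma mink_sqrD x y : mink (x + y) (x + y) = mink x x + 2 * mink x y + mink y y.
Proof. by rewrite !mink_bilinear (minkC y x); ring. Qed.

Lemma mink_neq0l x y : mink x y != 0 -> x != 0.
Proof. by apply: contra => /eqP ->; rewrite mink0l. Qed.

Lemma mink_neq0r x y : mink x y != 0 -> y != 0.
Proof. by rewrite minkC => /mink_neq0l. Qed.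

Lemma nullZ c u : null u -> null (c *: u).
Proof. by rewrite /null !mink_bilinear => ->; rewrite !mulr0. Qed.

Lemma nullN u : null u -> null (- u).
Proof. by rewrite -scaleN1r; apply: nullZ. Qed.

Lemma mink_map (tau : {rmorphism F -> F}) x y :
  mink (map_mx tau x) (map_mx tau y) = tau (mink x y).
Proof.
rewrite rmorph_sum; apply: eq_bigr => i _; rewrite !mxE !rmorphM.
by case: ifP => _; rewrite ?rmorphN rmorph1.
Qed.

Lemma exists_orthogonal u v w :
  exists z, [/\ z != 0, mink z u = 0, mink z v = 0 & mink z w = 0].
Proof.
pose A : 'M[F]_(4, 3) :=
  \matrix_(i, j) ((if i == 3%N :> nat then 1 else -1) * [:: u; v; w]`_j i 0).
have /rowV0Pn[r /sub_kermxP rA r_neq0] : kermx A != 0.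
  by rewrite -mxrank_eq0 mxrank_ker -lt0n subn_gt0 ltnS rank_leq_col.
have r_orth j (j_lt3 : (j < 3)%N) : mink r^T [:: u; v; w]`_j = 0.
  transitivity ((r *m A) 0 (Ordinal j_lt3)); last by rewrite rA mxE.
  by rewrite mxE; apply: eq_bigr => i _; rewrite !mxE; ring.
exists r^T; split; first by rewrite -(inj_eq trmx_inj) trmxK trmx0.
- exact: r_orth 0%N isT.
- exact: r_orth 1%N isT.
- exact: r_orth 2%N isT.
Qed.

Hypothesis two_neq0 : 2 != 0 :> F.

Lemma null_add_orthogonal u v : null u -> null v ->
  null (u + v) <-> mink u v = 0.
Proof.
move=> u_null v_null; rewrite /null mink_sqrD u_null v_null add0r addr0.
by split=> [/eqP|->]; rewrite ?mulr0 // mulf_eq0 (negPf two_neq0) => /eqP.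
Qed.

Lemma null_combination u v w a b : null u -> null v -> null w ->
    null (u + a *: v - b *: w) ->
  a * mink u v - b * mink u w - b * a * mink w v = 0.
Proof.
rewrite /null => u_null v_null w_null.
rewrite !mink_bilinear u_null v_null w_null (minkC w u) (minkC v u) (minkC v w).
by move=> comb_null; apply: (mulfI two_neq0); rewrite mulr0 -comb_null; ring.
Qed.

Lemma null_hyperbolic_add u v z : null u -> null v ->
    mink z u = 0 -> mink z v = 0 -> 2 * mink u v = - mink z z ->
  null (u + v + z).
Proof.
rewrite /null => u_null v_null zu zv uv.
rewrite mink_sqrD mink_sqrD u_null v_null uv minkDl !(minkC _ z) zu zv; ring.
Qed.

(* The parts of the form that are even and odd in [z] vanish separately. *)
Lemma null_hyperbolic_split u v z : null u -> null v ->
    null (u + v + z) -> null (u + v - z) ->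
  2 * mink u v = - mink z z /\ mink u z = - mink v z.
Proof.
rewrite /null => u_null v_null plus_null minus_null.
pose q x := mink x x.
have even_part : q (u + v + z) + q (u + v - z) = 2 * (2 * mink u v + mink z z).
  rewrite /q !mink_bilinear u_null v_null.
  by rewrite (minkC z u) (minkC z v) (minkC v u); ring.
have odd_part : q (u + v + z) - q (u + v - z) = 2 * (2 * (mink u z + mink v z)).
  rewrite /q !mink_bilinear u_null v_null.
  by rewrite (minkC z u) (minkC z v) (minkC v u); ring.
split; apply/eqP; rewrite -addr_eq0.
  move/eqP: even_part; rewrite /q plus_null minus_null addr0 eq_sym.
  by rewrite mulf_eq0 (negPf two_neq0).
move/eqP: odd_part; rewrite /q plus_null minus_null subr0 eq_sym.
by rewrite !mulf_eq0 (negPf two_neq0).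
Qed.

End MinkowskiForm.

Section LightconeCoordinates.
Variables (F : fieldType) (two_neq0 : 2 != 0 :> F).
Implicit Types a b c y z : F.

(* [a] and [b] are the null coordinates [t - x] and [t + x]. *)
Definition lightcone (a b y z : F) : 'cV[F]_4 :=
  \col_(i < 4) [:: (b - a) / 2; y; z; (a + b) / 2]`_i.

Variant lightcone_spec : 'cV[F]_4 -> Prop :=
  LightconeSpec a b y z : lightcone_spec (lightcone a b y z).

Lemma lightconeP (x : 'cV[F]_4) : lightcone_spec x.
Proof.
pose e k : F := x (inord k) 0.
suff -> : x = lightcone (e 3%N - e 0%N) (e 3%N + e 0%N) (e 1%N) (e 2%N) by [].
apply/colP=> i; rewrite !mxE -[x i 0]/(x i 0) -{1}(inord_val i) -/(e i).
by case: i => [[|[|[|[|]]]]] //= _; field.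
Qed.

Lemma lightconeD a b y z a' b' y' z' :
  lightcone a b y z + lightcone a' b' y' z' =
  lightcone (a + a') (b + b') (y + y') (z + z').
Proof. by apply/colP=> -[[|[|[|[|]]]]] //= ?; rewrite !mxE /=; field. Qed.

Lemma lightconeZ c a b y z :
  c *: lightcone a b y z = lightcone (c * a) (c * b) (c * y) (c * z).
Proof. by apply/colP=> -[[|[|[|[|]]]]] //= ?; rewrite !mxE /=; field. Qed.

Lemma lightconeB a b y z a' b' y' z' :
  lightcone a b y z - lightcone a' b' y' z' =
  lightcone (a - a') (b - b') (y - y') (z - z').
Proof. by rewrite -scaleN1r lightconeZ !mulN1r lightconeD. Qed.

Lemma lightcone0 : lightcone 0 0 0 0 = 0.
Proof. by rewrite -(scale0r (lightcone 0 0 0 0)) lightconeZ !mul0r. Qed.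

Lemma mink_lightcone a b y z a' b' y' z' :
  mink (lightcone a b y z) (lightcone a' b' y' z') =
  (a * b' + a' * b) / 2 - y * y' - z * z'.
Proof. by rewrite /mink !big_ord_recl big_ord0 !mxE /=; field. Qed.

Lemma mink_lightcone_sqr a b y z :
  mink (lightcone a b y z) (lightcone a b y z) = a * b - (y ^+ 2 + z ^+ 2).
Proof. by rewrite mink_lightcone; field. Qed.

Lemma null_lightcone a b y z :
  null (lightcone a b y z) <-> a * b = y ^+ 2 + z ^+ 2.
Proof.
rewrite /null mink_lightcone_sqr.
by split=> [/subr0_eq|->]; rewrite ?subrr.
Qed.

Lemma lightcone_eq0 a b y z :
  (lightcone a b y z == 0) = [&& a == 0, b == 0, y == 0 & z == 0].
Proof.
apply/eqP/and4P => [lc0|[/eqP-> /eqP-> /eqP-> /eqP->]]; last exact: lightcone0.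
have orth w : mink (lightcone a b y z) w = 0 by rewrite lc0 mink0l.
split; apply/eqP.
- by rewrite -(orth (lightcone 0 2 0 0)) mink_lightcone; field.
- by rewrite -(orth (lightcone 2 0 0 0)) mink_lightcone; field.
- by rewrite -(orth (lightcone 0 0 (-1) 0)) mink_lightcone; field.
- by rewrite -(orth (lightcone 0 0 0 (-1))) mink_lightcone; field.
Qed.

Lemma exists_null_nonorthogonal (x : 'cV[F]_4) : x != 0 ->
  exists2 u, null u & mink u x != 0.
Proof.
case: (lightconeP x) => a b y z x_neq0.
have [a0|a_neq0] := eqVneq a 0; last first.
  exists (lightcone 0 2 0 0); first by apply/null_lightcone; ring.
  by rewrite mink_lightcone (_ : _ - _ = a) //; field.
have [b0|b_neq0] := eqVneq b 0; last first.
  exists (lightcone 2 0 0 0); first by apply/null_lightcone; ring.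
  by rewrite mink_lightcone (_ : _ - _ = b) //; field.
have [y0|y_neq0] := eqVneq y 0; last first.
  exists (lightcone 1 1 (-1) 0); first by apply/null_lightcone; ring.
  by rewrite mink_lightcone a0 b0 (_ : _ - _ = y) //; field.
exists (lightcone 1 1 0 (-1)); first by apply/null_lightcone; ring.
rewrite mink_lightcone a0 b0 y0 (_ : _ - _ = z); last by field.
by move: x_neq0; rewrite lightcone_eq0 a0 b0 y0 eqxx.
Qed.

Lemma null_sum_ind (P : 'cV[F]_4 -> Prop) :
    (forall u, null u -> P u) -> (forall u v, P u -> P v -> P (u + v)) ->
  forall x, P x.
Proof.
move=> Pnull PD x; case: (lightconeP x) => a b y z.
have -> : lightcone a b y z =
    lightcone (a - y - z) 0 0 0 + lightcone 0 (b - y - z) 0 0 +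
    lightcone y y y 0 + lightcone z z 0 z.
  by rewrite !lightconeD; congr lightcone; ring.
by do 3?[apply: (PD)]; apply: Pnull; apply/null_lightcone; ring.
Qed.

End LightconeCoordinates.

Section WittIndexOne.
Variable F : fieldType.
Hypothesis sqr_neqN1 : forall i : F, i ^+ 2 != -1.

Lemma two_neq0_of_sqr_neqN1 : 2 != 0 :> F.
Proof. by have := sqr_neqN1 1; rewrite expr1n -addr_eq0. Qed.

Let two_neq0 := two_neq0_of_sqr_neqN1.

Lemma sum_sqr_eq0 (y z : F) : y ^+ 2 + z ^+ 2 = 0 -> y = 0 /\ z = 0.
Proof.
have [->|z_neq0] := eqVneq z 0.
  by rewrite expr0n addr0 => /eqP; rewrite sqrf_eq0 => /eqP.
move=> /eqP; rewrite addr_eq0 => /eqP yz; have /eqP[] := sqr_neqN1 (y / z).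
by rewrite expr_div_n yz mulNr divff // sqrf_eq0.
Qed.

Implicit Types u v w : 'cV[F]_4.

Lemma null_lightcone0_eq0 (b y z : F) :
  null (lightcone 0 b y z) -> y = 0 /\ z = 0.
Proof.
by move/null_lightcone; rewrite mul0r => /(_ two_neq0)/esym/sum_sqr_eq0.
Qed.

Lemma null_parallel u v : null u -> null v -> v != 0 -> mink u v = 0 ->
  exists c, u = c *: v.
Proof.
case: (lightconeP two_neq0 u) => a b y z.
case: (lightconeP two_neq0 v) => a' b' y' z'.
move=> u_null v_null v_neq0 uv.
have [a'0|a'_neq0] := eqVneq a' 0.
  move: v_null v_neq0 uv; rewrite a'0 => /null_lightcone0_eq0[-> ->] v_neq0.
  have b'_neq0 : b' != 0 by apply: contra v_neq0 => /eqP ->; rewrite lightcone0.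
  rewrite mink_lightcone // mul0r !mulr0 !subr0 addr0 => /eqP.
  rewrite !mulf_eq0 invr_eq0 (negPf two_neq0) (negPf b'_neq0) !orbF => /eqP a0.
  move: u_null; rewrite a0 => /null_lightcone0_eq0[-> ->].
  by exists (b / b'); rewrite lightconeZ // !mulr0 divfK.
exists (a / a').
set w := lightcone a b y z - (a / a') *: lightcone a' b' y' z'.
have w_null : null w.
  rewrite /w /null !mink_bilinear u_null v_null (minkC (lightcone a' _ _ _)) uv.
  by ring.
have wE : w = lightcone 0 (b - a / a' * b') (y - a / a' * y') (z - a / a' * z').
  by rewrite /w lightconeZ // lightconeB // divfK // subrr.
have [y0 z0] : y - a / a' * y' = 0 /\ z - a / a' * z' = 0.
  by apply: (null_lightcone0_eq0 (b := b - a / a' * b')); rewrite -wE.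
apply/subr0_eq; rewrite -/w wE y0 z0.
have : mink w (lightcone a' b' y' z') = 0.
  by rewrite /w !mink_bilinear uv v_null mulr0 subrr.
rewrite wE y0 z0 mink_lightcone // !mul0r add0r !subr0 => /eqP.
rewrite !mulf_eq0 invr_eq0 (negPf two_neq0) (negPf a'_neq0) orbF /= => /eqP ->.
exact: lightcone0.
Qed.

Lemma null_orthogonal_trans u v w : null u -> null v -> v != 0 ->
  mink u v = 0 -> mink v w = 0 -> mink u w = 0.
Proof.
move=> u_null v_null v_neq0 uv vw.
have [c ->] := null_parallel u_null v_null v_neq0 uv.
by rewrite minkZl vw mulr0.
Qed.

Lemma mink_orthogonal_hyperbolic_neq0 u v z : null u -> mink v u != 0 ->
  z != 0 -> mink z u = 0 -> mink z v = 0 -> mink z z != 0.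
Proof.
move=> u_null vu z_neq0 zu zv; apply: contra z_neq0 => /eqP z_null.
have [c zE] := null_parallel z_null u_null (mink_neq0r vu) zu.
move: zv; rewrite zE minkZl minkC => /eqP.
by rewrite mulf_eq0 (negPf vu) orbF => /eqP ->; rewrite scale0r.
Qed.

(* A null [w] orthogonal to [y] is the sum of [w/2 + t u + z], [w/2 + t u - z]
   and [- 2 t u] for a null [u] not orthogonal to [y], some [z] orthogonal to
   [w], [u], [y] and the scalar [t] that makes the first two null. *)
Lemma null_nonorthogonal_ind (y : 'cV[F]_4) (P : 'cV[F]_4 -> Prop) : y != 0 ->
    (forall u, null u -> mink u y != 0 -> P u) ->
    (forall u v, P u -> P v -> P (u + v)) ->
  forall x, P x.
Proof.
move=> y_neq0 Pnull PD; apply: (null_sum_ind two_neq0 _ PD) => w w_null.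
have [wy|] := eqVneq (mink w y) 0; last exact: Pnull.
have [u u_null uy] := exists_null_nonorthogonal two_neq0 y_neq0.
have PuZ c : c != 0 -> P (c *: u).
  by move=> c_neq0; apply: Pnull; rewrite ?minkZl ?mulf_neq0 //; apply: nullZ.
have [->|w_neq0] := eqVneq w 0.
  rewrite -(subrr u) -scaleN1r; apply: PD; first exact: Pnull.
  by apply: PuZ; rewrite oppr_eq0 oner_eq0.
have wu : mink w u != 0.
  apply: contra uy => /eqP; rewrite minkC => uw; apply/eqP.
  exact: (null_orthogonal_trans u_null w_null).
have [z [z_neq0 zw zu zy]] := exists_orthogonal w u y.
have zz := mink_orthogonal_hyperbolic_neq0 u_null wu z_neq0 zu zw.
pose t := - mink z z / mink w u.
have t_neq0 : t != 0 by rewrite mulf_neq0 ?oppr_eq0 ?invr_eq0.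
have Phalf e : e ^+ 2 = 1 -> P (2^-1 *: w + t *: u + e *: z).
  move=> e2; apply: Pnull.
    apply: null_hyperbolic_add; try exact: nullZ.
    - by rewrite minkZl minkZr zw !mulr0.
    - by rewrite minkZl minkZr zu !mulr0.
    - rewrite !minkZl !minkZr [e * _]mulrA -expr2 e2 /t.
      by field; rewrite wu two_neq0.
  by rewrite !minkDl !minkZl wy zy !mulr0 addr0 add0r mulf_neq0.
have -> : w = 2^-1 *: w + t *: u + 1 *: z + (2^-1 *: w + t *: u + -1 *: z) +
    (- (2 * t)) *: u.
  by apply/colP=> i; rewrite !mxE; field.
apply: (PD); last by apply: PuZ; rewrite oppr_eq0 mulf_neq0.
by apply: PD; apply: Phalf; rewrite ?sqrrN expr1n.
Qed.

End WittIndexOne.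

Lemma card_affine_line (F : finFieldType) (a b c : F) :
  (a != 0) || (b != 0) -> #|[set y : F * F | a * y.1 + b * y.2 == c]| = #|F|.
Proof.
have solve (k l y z : F) :
    k != 0 -> (k * y + l * z == c) = (y == (c - l * z) / k).
  move=> k_neq0; rewrite -[RHS](inj_eq (mulIf k_neq0)) divfK // [RHS]eq_sym.
  by rewrite subr_eq mulrC eq_sym.
case/orP=> [a_neq0|b_neq0].
  have param_inj : injective (fun z => ((c - b * z) / a, z)) by move=> z z' [].
  rewrite -[RHS](card_imset _ param_inj); apply: eq_card => -[y z].
  rewrite inE solve //=.
  by apply/eqP/imsetP => [->|[_ _ [-> ->]] //]; exists z.
have param_inj : injective (fun y => (y, (c - a * y) / b)) by move=> y y' [].
rewrite -[RHS](card_imset _ param_inj); apply: eq_card => -[y z].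
rewrite inE /= addrC solve //.
by apply/eqP/imsetP => [->|[_ _ [-> ->]] //]; exists y.
Qed.

Section NullColoring.
Variable F : finFieldType.
Hypothesis two_neq0 : 2 != 0 :> F.

Definition squared_dist (p y : F * F) : F :=
  (y.1 - p.1) ^+ 2 + (y.2 - p.2) ^+ 2.

Lemma exists_null_between_slices (g0 g1 : F * F -> F) :
  exists p y, g0 p + squared_dist p y = g1 y.
Proof.
have F_gt0 : (0 < #|F|)%N by apply/card_gt0P; exists 0.
apply: universal_family_meets_section; rewrite ?card_prod ?muln_gt0 ?F_gt0 //;
  last by rewrite mulnn -[X in (X < _)%N]addn0 ltn_add2l.
move=> p p' p'p; congr (_ * _)%N.
pose norm2 (x : F * F) := x.1 ^+ 2 + x.2 ^+ 2.
rewrite -(@card_affine_line F (2 * (p'.1 - p.1)) (2 * (p'.2 - p.2))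
  (g0 p' + norm2 p' - (g0 p + norm2 p))).
  apply: eq_card => y; rewrite !inE eq_sym.
  rewrite -subr_eq0 -[in RHS]subr_eq0; congr (_ == _).
  by rewrite /norm2 /squared_dist; ring.
rewrite !mulf_eq0 (negPf two_neq0) /= !subr_eq0.
by move: p'p; case: p p' => [y z] [y' z']; rewrite xpair_eqE negb_and.
Qed.

Definition null_coloring (f : 'cV[F]_4 -> F) : Prop :=
  forall x y, null (x - y) -> x != y -> f x != f y.

(* Each null line [b |-> lightcone a b y z] meets every color exactly once. *)
Lemma null_coloring_slice f a : null_coloring f ->
  exists g : F * F -> F, forall p, f (lightcone a (g p) p.1 p.2) = 0.
Proof.
move=> f_coloring.
have slice_colors p : exists b, f (lightcone a b p.1 p.2) = 0.
  have f_inj : injective (fun b => f (lightcone a b p.1 p.2)).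
    move=> b b' fbb'; apply/eqP; apply: contraT => bb'.
    have := f_coloring (lightcone a b p.1 p.2) (lightcone a b' p.1 p.2).
    rewrite fbb' eqxx -subr_eq0 lightconeB // lightcone_eq0 // !subrr.
    rewrite subr_eq0 (negPf bb') andbF => not_null; apply: not_null => //.
    by apply/null_lightcone => //; ring.
  by have [g _ gK] := injF_bij f_inj; exists (g 0).
by have [g gE] := fin_all_exists slice_colors; exists g.
Qed.

Lemma no_null_coloring f : ~ null_coloring f.
Proof.
move=> f_coloring.
have [g0 g0E] := null_coloring_slice 0 f_coloring.
have [g1 g1E] := null_coloring_slice 1 f_coloring.
have [p [y g1y]] := exists_null_between_slices g0 g1.
have := f_coloring (lightcone 1 (g1 y) y.1 y.2) (lightcone 0 (g0 p) p.1 p.2).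
rewrite g0E g1E eqxx -subr_eq0 lightconeB // lightcone_eq0 // subr0 oner_eq0.
suff sep : null (lightcone 1 (g1 y - g0 p) (y.1 - p.1) (y.2 - p.2)).
  by move=> /(_ sep isT).
by apply/null_lightcone => //; rewrite -g1y /squared_dist; ring.
Qed.

End NullColoring.

Definition null_preserving (F : fieldType) (psi : 'cV[F]_4 -> 'cV[F]_4) :=
  forall r1 r2, null (r1 - r2) -> r1 != r2 ->
  null (psi r1 - psi r2) /\ psi r1 != psi r2.

Section Displacement.
Variables (V W : zmodType) (psi : V -> W).

Definition displ (x u : V) : W := psi (x + u) - psi x.

Lemma displ0 x : displ x 0 = 0.
Proof. by rewrite /displ addr0 subrr. Qed.

Lemma displD x u v : displ x (u + v) = displ x u + displ (x + u) v.
Proof. by rewrite /displ addrA [RHS]addrC addrA subrK. Qed.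

Lemma displB x u v : displ (x + u) (v - u) = displ x v - displ x u.
Proof. by rewrite -[in RHS](subrKC u v) [in RHS]displD [RHS]addrC addKr. Qed.

Lemma displ_swap x u v :
  displ (x + u) v - displ x v = displ (x + v) u - displ x u.
Proof.
have comm : displ x u + displ (x + u) v = displ x v + displ (x + v) u.
  by rewrite -!displD addrC.
by apply: (addrI (displ x u)); rewrite addrA comm subrKC addrAC subrr add0r.
Qed.

End Displacement.

Section NullPreserving.
Variable F : finFieldType.
Hypothesis sqr_neqN1 : forall i : F, i ^+ 2 != -1.
Variable psi : 'cV[F]_4 -> 'cV[F]_4.
Hypothesis psi_null : null_preserving psi.
Implicit Types (x y z u v w d : 'cV[F]_4) (s : F).
Let two_neq0 := two_neq0_of_sqr_neqN1 sqr_neqN1.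
Local Notation displ := (displ psi).
Local Notation dir := (displ 0).

Lemma displ_null_neq0 x u : null u -> u != 0 ->
  null (displ x u) /\ displ x u != 0.
Proof.
move=> u_null u_neq0; have xu : x + u - x = u by rewrite addrC addKr.
rewrite /displ subr_eq0; apply: psi_null; first by rewrite xu.
by rewrite -subr_eq0 xu.
Qed.

Lemma displ_neq0 x u : null u -> u != 0 -> displ x u != 0.
Proof. by move=> u_null u_neq0; have [] := displ_null_neq0 x u_null u_neq0. Qed.

Lemma displ_null x u : null u -> null (displ x u).
Proof.
move=> u_null; have [->|u_neq0] := eqVneq u 0.
  by rewrite displ0 /null mink0l.
by have [] := displ_null_neq0 x u_null u_neq0.
Qed.

Lemma displ_orthogonal x u v : null u -> null v -> null (v - u) ->
  mink (displ x v) (displ x u) = 0.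
Proof.
move=> u_null v_null /(displ_null (x + u)); rewrite displB => uv_null.
have u_nullN := nullN (displ_null x u_null).
move/(null_add_orthogonal two_neq0 (displ_null x v_null) u_nullN)/eqP: uv_null.
by rewrite minkNr oppr_eq0 => /eqP.
Qed.

Lemma displ_line x u : null u -> u != 0 ->
  exists2 c, injective c & forall s : F, displ x (s *: u) = c s *: displ x u.
Proof.
move=> u_null u_neq0.
have proportional s : exists c, displ x (s *: u) = c *: displ x u.
  have su_null := nullZ s u_null.
  apply: (null_parallel sqr_neqN1); rewrite ?displ_neq0 //.
  - exact: displ_null.
  - exact: displ_null.
  apply: displ_orthogonal => //.
  by rewrite -[X in _ - X]scale1r -scalerBl; apply: nullZ.
have [c cE] := fin_all_exists proportional; exists c => // s t cst.
apply/eqP; rewrite -subr_eq0; apply: contraT => st_neq0.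
have := displ_neq0 (x + t *: u) (nullZ (s - t) u_null).
rewrite scaler_eq0 negb_or st_neq0 scalerBl displB !cE cst subrr eqxx.
by move/(_ u_neq0).
Qed.

(* Null vectors perfectly match the parallel null lines [x + F u] and
   [x + w + F u]; lines of different directions have no perfect matching. *)
Lemma displ_parallel_matched x u w : null u -> u != 0 -> null w ->
  mink (displ x u) (displ (x + w) u) = 0.
Proof.
move=> u_null u_neq0 w_null; apply/eqP; apply: contraT => mn_neq0.
have [c c_inj cE] := displ_line x u_null u_neq0.
have [c' c'_inj c'E] := displ_line (x + w) u_null u_neq0.
set m := displ x u in mn_neq0 cE; set n := displ (x + w) u in mn_neq0 c'E.
pose e := displ x w.
have matched s : c' s * mink e n - c s * mink e m - c s * c' s * mink m n = 0.
  have := displ_null (x + s *: u) w_null.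
  have -> : displ (x + s *: u) w = e + c' s *: n - c s *: m.
    have /eqP := displ_swap psi x (s *: u) w; rewrite cE c'E subr_eq => /eqP ->.
    by rewrite addrC addrA.
  by apply: null_combination => //; apply: displ_null.
(* [matched] factors: [f s * g s] is the constant [mink e n * mink e m]. *)
pose f s := mink e n - mink m n * c s; pose g s := mink e m + mink m n * c' s.
have [||s /eqP[]] := injective_mul_not_const (mink e n * mink e m)
  (finField_card_gt2 two_neq0) (f := f) (g := g).
- by move=> s t /addrI/oppr_inj/(mulfI mn_neq0)/c_inj.
- by move=> s t /addrI/(mulfI mn_neq0)/c'_inj.
rewrite -[RHS]addr0 -[in RHS](mulr0 (mink m n)) -[in RHS](matched s).
by rewrite /f /g; ring.
Qed.

Lemma displ_parallel x y u : null u -> mink (displ x u) (displ y u) = 0.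
Proof.
move=> u_null; have [->|u_neq0] := eqVneq u 0; first by rewrite displ0 mink0l.
rewrite -(subrKC x y).
suff transport z y' : mink (displ x u) (displ y' u) = 0 ->
    mink (displ x u) (displ (y' + z) u) = 0.
  by apply: transport; apply: displ_null.
elim/(null_sum_ind two_neq0): z y' => [w w_null|v w IHv IHw] y' xy'; last first.
  by rewrite addrA; apply/IHw/IHv.
apply: (null_orthogonal_trans sqr_neqN1 _ _ (displ_neq0 y' u_null u_neq0) xy').
- exact: displ_null.
- exact: displ_null.
exact: displ_parallel_matched.
Qed.

Lemma displ_proportional x y u : null u ->
  exists c, displ y u = c *: displ x u.
Proof.
move=> u_null; have [->|u_neq0] := eqVneq u 0.
  by exists 0; rewrite !displ0 scaler0.
apply: (null_parallel sqr_neqN1) (displ_parallel y x u_null).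
- exact: displ_null.
- exact: displ_null.
exact: displ_neq0.
Qed.

Lemma displ_scale x y u s : null u ->
  exists c, displ y (s *: u) = c *: displ x u.
Proof.
move=> u_null; have [->|u_neq0] := eqVneq u 0.
  by exists 0; rewrite scaler0 !displ0 scaler0.
have [c _ ->] := displ_line y u_null u_neq0.
have [k ->] := displ_proportional x y u_null.
by exists (c s * k); rewrite scalerA.
Qed.

Definition collapses d y : Prop := forall x, exists k, displ x y = k *: d.

Lemma collapsesD d y z : collapses d y -> collapses d z -> collapses d (y + z).
Proof.
move=> yd zd x; have [[k yE] [l zE]] := (yd x, zd (x + y)).
by exists (k + l); rewrite displD yE zE scalerDl.
Qed.

Lemma null_collapsesZ d u s : null u -> collapses d u -> collapses d (s *: u).
Proof.
move=> u_null ud x; have [[c ->] [k ->]] := (displ_scale 0 x s u_null, ud 0).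
by exists (c * k); rewrite scalerA.
Qed.

Lemma collapses_orthogonal d u : null d -> d != 0 -> null u ->
  mink (dir u) d = 0 -> collapses d u.
Proof.
move=> d_null d_neq0 u_null ud x.
have dir_null := displ_null 0 u_null.
have [k dirE] := null_parallel sqr_neqN1 dir_null d_null d_neq0 ud.
have [c ->] := displ_proportional 0 x u_null.
by exists (c * k); rewrite dirE scalerA.
Qed.

Lemma collapses_displ_transl d x y v : null d -> collapses d y -> null v ->
  mink d (dir v) != 0 -> displ (x + y) v = displ x v.
Proof.
move=> d_null yd v_null dv; apply/eqP; rewrite -subr_eq0.
have dir_v z : exists k, displ z v = k *: dir v by apply: displ_proportional.
have := displ_swap psi x y v.
have [[k ->] [l ->]] := (dir_v (x + y), dir_v x).
have [[k' ->] [l' ->]] := (yd (x + v), yd x).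
rewrite -!scalerBl => /(congr1 (mink d)); rewrite !minkZr d_null mulr0 => /eqP.
by rewrite mulf_eq0 (negPf dv) orbF => /eqP ->; rewrite scale0r.
Qed.

Lemma not_all_collapse d : ~ (forall y, collapses d y).
Proof.
move=> all_collapse.
have dir_line y : exists k, dir y = k *: d by apply: all_collapse.
have [f fE] := fin_all_exists dir_line.
apply: (@no_null_coloring F two_neq0 f) => x y xy_null xy.
have := displ_neq0 (0 + y) xy_null; rewrite displB !fE subr_eq0 => /(_ xy).
by apply: contra => /eqP->; rewrite subrr.
Qed.

Lemma collapses_displ_null_eq0 d x y w : null d -> collapses d y -> null w ->
  mink d (dir w) != 0 -> null (y + w) -> displ x y = 0.
Proof.
move=> d_null yd w_null dw yw_null; have [k kE] := yd x.
have [l lE] := displ_proportional x 0 w_null.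
have xy_null : null (displ x y) by rewrite kE; apply: nullZ.
have := displ_null x yw_null.
rewrite displD (collapses_displ_transl x d_null yd) //.
move/(null_add_orthogonal two_neq0 xy_null (displ_null x w_null)).
move: dw; rewrite kE lE minkZr mulf_eq0 negb_or => /andP[_ dw] /eqP.
by rewrite minkZl mulf_eq0 (negPf dw) orbF => /eqP->; rewrite scale0r.
Qed.

Lemma collapses_displ_eq0 d x y : null d -> d != 0 -> collapses d y ->
  mink y y != 0 -> displ x y = 0.
Proof.
move=> d_null d_neq0 yd yy; apply/eqP; apply: contraT => xy_neq0.
case: (@not_all_collapse d).
apply: (null_nonorthogonal_ind sqr_neqN1 (mink_neq0l yy)) (@collapsesD d).
move=> w w_null wy; pose t := - mink y y / (2 * mink w y).
have t_neq0 : t != 0 by rewrite mulf_neq0 ?oppr_eq0 ?invr_eq0 ?mulf_neq0.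
have tw_null := nullZ t w_null.
rewrite -[w](scalerK t_neq0); apply: null_collapsesZ => //.
apply: collapses_orthogonal => //; rewrite minkC; apply/eqP.
apply: contraT => d_tw; case/eqP: xy_neq0.
apply: (collapses_displ_null_eq0 x d_null yd tw_null d_tw).
rewrite /null mink_sqrD (tw_null : mink _ _ = 0) minkZr (minkC y w) /t.
by field; rewrite wy two_neq0.
Qed.

Lemma dir_nonorthogonal u v : null u -> null v -> mink u v != 0 ->
  mink (dir u) (dir v) != 0.
Proof.
move=> u_null v_null uv; apply/eqP=> dir_uv.
have [u_neq0 v_neq0] := (mink_neq0l uv, mink_neq0r uv).
have [d_null d_neq0] := displ_null_neq0 0 u_null u_neq0.
have ud : collapses (dir u) u by apply: collapses_orthogonal.
have vd : collapses (dir u) v by apply: collapses_orthogonal; rewrite // minkC.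
have sum_eq0 e x : e != 0 -> displ x (u + e *: v) = 0.
  move=> e_neq0; apply: (collapses_displ_eq0 _ d_null d_neq0).
    exact/collapsesD/null_collapsesZ.
  rewrite mink_sqrD (u_null : mink u u = 0) (nullZ e v_null : mink _ _ = 0).
  by rewrite addr0 add0r minkZr !mulf_neq0.
have u2_neq0 : 2 *: u != 0 by rewrite scaler_eq0 negb_or two_neq0.
have := displ_neq0 0 (nullZ 2 u_null) u2_neq0.
have -> : 2 *: u = (u + 1 *: v) + (u + -1 *: v).
  by rewrite scale1r scaleN1r addrACA subrr addr0 scaler_nat.
by rewrite displD !sum_eq0 ?oppr_eq0 ?oner_eq0 // addr0 eqxx.
Qed.

Lemma displ_null_transl x y v : null v -> displ (x + y) v = displ x v.
Proof.
move=> v_null; have [->|v_neq0] := eqVneq v 0; first by rewrite !displ0.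
move: y x; apply: (null_nonorthogonal_ind sqr_neqN1 v_neq0);
  last by move=> y z IHy IHz x; rewrite addrA IHz IHy.
move=> u u_null uv x.
have [d_null d_neq0] := displ_null_neq0 0 u_null (mink_neq0l uv).
apply: (collapses_displ_transl x d_null) => //; last exact: dir_nonorthogonal.
exact: collapses_orthogonal.
Qed.

Lemma displ_eq_dir x y : displ x y = dir y.
Proof.
elim/(null_sum_ind two_neq0): y x => [v v_null|v w IHv IHw] x.
  by rewrite -[x]add0r displ_null_transl.
by rewrite !displD IHv IHw [in RHS]IHw.
Qed.

End NullPreserving.

Lemma morphD_zmod_morphism (U V : zmodType) (f : U -> V) :
  {morph f : x y / x + y} -> zmod_morphism f.
Proof. by move=> fD x y; apply/eqP; rewrite eq_sym subr_eq -fD subrK. Qed.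

Lemma semilinear_mulmx (R : comNzRingType) (m n : nat)
    (f : {additive 'cV[R]_n -> 'cV[R]_m}) (tau : R -> R) :
    (forall c x, f (c *: x) = tau c *: f x) ->
  exists M : 'M[R]_(m, n), forall x, f x = M *m map_mx tau x.
Proof.
move=> fZ; exists (\matrix_(i, j) f (delta_mx j 0) i 0) => x.
rewrite {1}(matrix_sum_delta x); under eq_bigr do rewrite big_ord1.
rewrite raddf_sum; apply/colP=> i; rewrite summxE mxE; apply: eq_bigr => j _.
by rewrite fZ !mxE mulrC.
Qed.

Section AdditiveNullPreserver.
Variable F : fieldType.
Hypothesis sqr_neqN1 : forall i : F, i ^+ 2 != -1.
Hypothesis sqr_or_Nsqr : forall c : F, exists s, c = s ^+ 2 \/ c = - s ^+ 2.
Variable phi : {additive 'cV[F]_4 -> 'cV[F]_4}.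
Hypothesis phi_null : forall u, null u -> null (phi u).
Hypothesis phi_line : forall u s, null u -> exists c, phi (s *: u) = c *: phi u.
Hypothesis phi_nonorthogonal : forall u v, null u -> null v -> mink u v != 0 ->
  mink (phi u) (phi v) != 0.
Implicit Types (u v w x : 'cV[F]_4) (a b c s y z : F).
Let two_neq0 := two_neq0_of_sqr_neqN1 sqr_neqN1.

Local Notation ea := (lightcone 1 0 0 0 : 'cV[F]_4).
Local Notation eb := (lightcone 0 1 0 0 : 'cV[F]_4).
Local Notation transverse y z := (lightcone 0 0 y z).
Local Notation factor := (mink (phi ea) (phi eb)).

Let ea_null : null ea. Proof. by apply/null_lightcone => //; ring. Qed.
Let eb_null : null eb. Proof. by apply/null_lightcone => //; ring. Qed.

Lemma factor_neq0 : factor != 0.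
Proof.
apply: phi_nonorthogonal => //; rewrite mink_lightcone //.
by rewrite (_ : _ - _ = 2^-1) ?invr_eq0 //; field.
Qed.

Lemma phi_hyperbolic_split a b y z : a * b = y ^+ 2 + z ^+ 2 ->
  let w := transverse y z in
  2 * mink (phi (a *: ea)) (phi (b *: eb)) = - mink (phi w) (phi w) /\
  mink (phi (a *: ea)) (phi w) = - mink (phi (b *: eb)) (phi w).
Proof.
move=> ab w; apply: null_hyperbolic_split => //; try exact/phi_null/nullZ.
  rewrite -!raddfD !lightconeZ // !lightconeD //; apply: phi_null.
  by apply/null_lightcone => //; rewrite !(mulr1, mulr0, addr0, add0r).
rewrite -raddfD -raddfB !lightconeZ // lightconeD // lightconeB //.
apply: phi_null; apply/null_lightcone => //.
by rewrite !(mulr1, mulr0, addr0, add0r, subr0, sub0r) !sqrrN.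
Qed.

Lemma mink_phi_cross a b :
  mink (phi (a *: ea)) (phi (b *: eb)) = mink (phi ((a * b) *: ea)) (phi eb).
Proof.
pose cross a' b' := mink (phi (a' *: ea)) (phi (b' *: eb)).
have cross_sqr a' b' s : a' * b' = s ^+ 2 -> cross a' b' = cross (a' * b') 1.
  move=> ab; apply: (mulfI two_neq0); rewrite /cross.
  have [|-> _] := @phi_hyperbolic_split a' b' s 0; first by rewrite ab; ring.
  have [|-> _] //= := @phi_hyperbolic_split (a' * b') 1 s 0.
  by rewrite ab; ring.
rewrite -[eb in RHS]scale1r.
have [s [|ab]] := sqr_or_Nsqr (a * b); first exact: cross_sqr.
apply: oppr_inj; rewrite -!minkNl -![- phi _]raddfN -!scaleNr -mulNr.
by apply: (cross_sqr _ _ s); rewrite mulNr ab opprK.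
Qed.

Lemma companion_automorphism : exists tau : {rmorphism F -> F},
  (forall a, phi (a *: ea) = tau a *: phi ea) /\
  (forall b, phi (b *: eb) = tau b *: phi eb).
Proof.
pose t a := mink (phi (a *: ea)) (phi eb) / factor.
have t_ea a : phi (a *: ea) = t a *: phi ea.
  by have [c cE] := phi_line a ea_null; rewrite /t cE minkZl mulfK ?factor_neq0.
have t_eb b : phi (b *: eb) = t b *: phi eb.
  have [c cE] := phi_line b eb_null; rewrite cE; congr (_ *: _).
  apply: (mulIf factor_neq0); rewrite divfK ?factor_neq0 //.
  by rewrite -[b in RHS]mul1r -mink_phi_cross scale1r cE minkZr.
have t_additive : zmod_morphism t.
  apply: morphD_zmod_morphism => a b.
  by rewrite /t scalerDl raddfD minkDl mulrDl.
have t_multiplicative : monoid_morphism t.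
  split=> [|a b]; first by rewrite /t scale1r divff ?factor_neq0.
  apply: (mulIf factor_neq0); rewrite divfK ?factor_neq0 //.
  by rewrite -mink_phi_cross t_ea t_eb minkZl minkZr mulrA.
pose tau : {rmorphism F -> F} := HB.pack t
  (GRing.isZmodMorphism.Build F F t t_additive)
  (GRing.isMonoidMorphism.Build F F t t_multiplicative).
by exists tau; split=> a; rewrite ?t_ea ?t_eb.
Qed.

Lemma lightcone_decomp a b y z :
  lightcone a b y z = a *: ea + b *: eb + transverse y z.
Proof. by rewrite !lightconeZ // !lightconeD //; congr lightcone; ring. Qed.

Section Companion.
Variable tau : {rmorphism F -> F}.
Hypothesis phiZ_ea : forall a, phi (a *: ea) = tau a *: phi ea.
Hypothesis phiZ_eb : forall b, phi (b *: eb) = tau b *: phi eb.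

Lemma mink_phi_transverse_sqr y z :
  mink (phi (transverse y z)) (phi (transverse y z)) =
  - (2 * factor * tau (y ^+ 2 + z ^+ 2)).
Proof.
have [|] := @phi_hyperbolic_split 1 (y ^+ 2 + z ^+ 2) y z.
  by rewrite mul1r.
rewrite scale1r phiZ_eb minkZr => /esym/eqP; rewrite eqr_oppLR => /eqP-> _.
by ring.
Qed.

Lemma mink_phi_ea_transverse y z :
  mink (phi ea) (phi (transverse y z)) =
  - (tau (y ^+ 2 + z ^+ 2) * mink (phi eb) (phi (transverse y z))).
Proof.
have [|_] := @phi_hyperbolic_split 1 (y ^+ 2 + z ^+ 2) y z.
  by rewrite mul1r.
by rewrite scale1r phiZ_eb minkZl.
Qed.

(* Compare the relation [mink_phi_ea_transverse] at [(y, z)], at its quarter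
   turn [(-z, y)] and at their sum, whose norm is twice that of [(y, z)]. *)
Lemma phi_transverse_quarter_turn y z :
  mink (phi eb) (phi (transverse (- z) y)) =
  - mink (phi eb) (phi (transverse y z)).
Proof.
set v := transverse y z; set v' := transverse (- z) y; set N := y ^+ 2 + z ^+ 2.
have sumE : transverse (y - z) (z + y) = v + v' by rewrite lightconeD // addr0.
have normE : (y - z) ^+ 2 + (z + y) ^+ 2 = N + N by rewrite /N; ring.
have norm'E : (- z) ^+ 2 + y ^+ 2 = N by rewrite /N; ring.
have [/(sum_sqr_eq0 sqr_neqN1)[y0 z0]|N_neq0] := eqVneq N 0.
  by rewrite /v /v' y0 z0 oppr0 lightcone0 // raddf0 mink0r oppr0.
have := mink_phi_ea_transverse (y - z) (z + y).
rewrite sumE normE raddfD !minkDr rmorphD !mink_phi_ea_transverse norm'E.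
rewrite -/v -/v' -/N => /eqP; rewrite -subr_eq0.
set b := mink _ (phi v); set b' := mink _ (phi v').
have -> : - (tau N * b) - tau N * b' - - ((tau N + tau N) * (b + b')) =
    tau N * (b' + b) by ring.
by rewrite mulf_eq0 fmorph_eq0 (negPf N_neq0) addr_eq0 => /eqP.
Qed.

Lemma phi_transverse_orthogonal y z :
  mink (phi ea) (phi (transverse y z)) = 0 /\
  mink (phi eb) (phi (transverse y z)) = 0.
Proof.
have eb_orth : mink (phi eb) (phi (transverse y z)) = 0.
  have := phi_transverse_quarter_turn (- z) y.
  rewrite (phi_transverse_quarter_turn y z) opprK.
  have -> : transverse (- y) (- z) = - transverse y z.
    by rewrite -scaleN1r lightconeZ // !mulr0 !mulN1r.
  rewrite raddfN minkNr => /eqP; rewrite eq_sym -addr_eq0 -mulr2n -mulr_natl.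
  by rewrite mulf_eq0 (negPf two_neq0) => /eqP.
by rewrite mink_phi_ea_transverse eb_orth mulr0 oppr0.
Qed.

Lemma phi_transverseZ s y z : y ^+ 2 + z ^+ 2 = 1 ->
  phi (s *: transverse y z) = tau s *: phi (transverse y z).
Proof.
move=> yz; have w_null : null (lightcone 1 1 y z).
  by apply/null_lightcone => //; rewrite yz mulr1.
have [k] := phi_line s w_null.
rewrite lightcone_decomp !scale1r !scalerDr !raddfD /= phiZ_ea phiZ_eb.
move=> phi_sw.
suff kE : k = tau s by move: phi_sw; rewrite kE => /addrI.
have := congr1 (mink (phi eb)) phi_sw; rewrite !mink_bilinear.
rewrite lightconeZ // mulr0 !(phi_transverse_orthogonal _ _).2.
rewrite (phi_null eb_null) !mulr0 !addr0 (minkC (phi eb)).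
by move/(mulIf factor_neq0).
Qed.

Lemma phi_semilinear c x : phi (c *: x) = tau c *: phi x.
Proof.
have phi_lightcone a b y z : phi (lightcone a b y z) =
    tau a *: phi ea + tau b *: phi eb +
    (tau y *: phi (transverse 1 0) + tau z *: phi (transverse 0 1)).
  have -> : lightcone a b y z =
      a *: ea + b *: eb + (y *: transverse 1 0 + z *: transverse 0 1).
    by rewrite !lightconeZ // !lightconeD //; congr lightcone; ring.
  by rewrite !raddfD phiZ_ea phiZ_eb !phi_transverseZ //; ring.
case: (lightconeP two_neq0 x) => a b y z.
rewrite lightconeZ // (phi_lightcone a) (phi_lightcone (c * a)) !rmorphM.
by rewrite !scalerDr !scalerA.
Qed.

Lemma mink_phi u v : mink (phi u) (phi v) = 2 * factor * tau (mink u v).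
Proof.
have mink_phi_sqr w : mink (phi w) (phi w) = 2 * factor * tau (mink w w).
  case: (lightconeP two_neq0 w) => a b y z.
  have [ea_orth eb_orth] := phi_transverse_orthogonal y z.
  rewrite mink_lightcone_sqr // lightcone_decomp !(raddfD phi) phiZ_ea phiZ_eb.
  rewrite !mink_sqrD mink_phi_transverse_sqr !minkDl !minkZl !minkZr.
  rewrite (phi_null ea_null) (phi_null eb_null) ea_orth eb_orth.
  by rewrite rmorphB rmorphM; ring.
apply: (mulfI two_neq0).
transitivity
  (mink (phi (u + v)) (phi (u + v)) - mink (phi u) (phi u) -
   mink (phi v) (phi v)).
  by rewrite (raddfD phi) mink_sqrD; ring.
rewrite !mink_phi_sqr mink_sqrD !rmorphD rmorphM rmorph_nat; ring.
Qed.

End Companion.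

Lemma additive_null_preserver_semisimilarity :
  exists (tau : {rmorphism F -> F}) (k : F), [/\ k != 0,
    forall c x, phi (c *: x) = tau c *: phi x &
    forall u v, mink (phi u) (phi v) = k * tau (mink u v)].
Proof.
have [tau [phiZ_ea phiZ_eb]] := companion_automorphism.
exists tau, (2 * factor); split; first by rewrite mulf_neq0 ?factor_neq0.
  exact: phi_semilinear.
exact: mink_phi.
Qed.

End AdditiveNullPreserver.

Definition similarity (F : fieldType) (k : F) (M : 'M[F]_4) : Prop :=
  forall r1 r2 : 'cV[F]_4, mink (M *m r1) (M *m r2) = k * mink r1 r2.

Lemma lorentz_or_antilorentz_similarity (F : fieldType) (M : 'M[F]_4) :
  lorentz M \/ antilorentz M -> exists2 k, k != 0 & similarity k M.
Proof.
case=> LM; [exists 1|exists (-1)]; rewrite ?oppr_eq0 ?oner_eq0 // => r1 r2.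
  by rewrite LM mul1r.
by rewrite LM mulN1r.
Qed.

Lemma similarity_lorentz_or_antilorentz (F : fieldType) (k s : F)
    (M : 'M[F]_4) :
    s != 0 -> k = s ^+ 2 \/ k = - s ^+ 2 -> similarity k M ->
  lorentz (s^-1 *: M) \/ antilorentz (s^-1 *: M).
Proof.
move=> s_neq0 [] -> Msim; [left|right] => r1 r2;
  by rewrite -!scalemxAl minkZl minkZr Msim; field.
Qed.

Lemma similarity_mulmx_neq0 (F : fieldType) (k : F) (M : 'M[F]_4)
    (x : 'cV[F]_4) :
  2 != 0 :> F -> k != 0 -> similarity k M -> x != 0 -> M *m x != 0.
Proof.
move=> two_neq0 k_neq0 Msim x_neq0.
have [w _ wx] := exists_null_nonorthogonal two_neq0 x_neq0.
by apply: (@mink_neq0r _ (M *m w)); rewrite Msim mulf_neq0.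
Qed.

Lemma similarity_null_preserving (F : fieldType) (alpha k : F) (M : 'M[F]_4)
    (tau : {rmorphism F -> F}) (r0 : 'cV[F]_4) :
    2 != 0 :> F -> alpha != 0 -> k != 0 -> similarity k M ->
  null_preserving (fun r => alpha *: (M *m map_mx tau r) + r0).
Proof.
move=> two_neq0 alpha_neq0 k_neq0 Msim r1 r2 r_null r_neq.
rewrite -[X in _ /\ ~~ X]subr_eq0 opprD addrACA subrr addr0.
rewrite -scalerBr -mulmxBr -map_mxB; split.
  by apply: nullZ; rewrite /null Msim mink_map r_null rmorph0 mulr0.
rewrite scaler_eq0 negb_or alpha_neq0.
by apply: (similarity_mulmx_neq0 _ k_neq0); rewrite // map_mx_eq0 subr_eq0.
Qed.

Lemma semisimilarity_mulmx (F : finFieldType) (tau : {rmorphism F -> F}) (k : F)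
    (phi : {additive 'cV[F]_4 -> 'cV[F]_4}) :
    (forall c x, phi (c *: x) = tau c *: phi x) ->
    (forall x y, mink (phi x) (phi y) = k * tau (mink x y)) ->
  exists2 M, similarity k M & forall x, phi x = M *m map_mx tau x.
Proof.
move=> phiZ mink_phi; have [M phiM] := semilinear_mulmx phiZ.
exists M => // x y; have [sigma _ sigmaK] := injF_bij (fmorph_inj tau).
have mapK (z : 'cV[F]_4) : z = map_mx tau (map_mx sigma z).
  by apply/colP=> i; rewrite !mxE sigmaK.
by rewrite [x]mapK [y]mapK -!phiM mink_phi mink_map.
Qed.

Lemma null_preserving_similarity (F : finFieldType)
    (psi : 'cV[F]_4 -> 'cV[F]_4) :
    (#|F| %% 4 = 3)%N -> null_preserving psi ->
  exists (tau : {rmorphism F -> F}) (k : F) (M : 'M[F]_4),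
    [/\ k != 0, similarity k M & forall r, psi r = M *m map_mx tau r + psi 0].
Proof.
move=> card_mod4 psi_null.
have sqr_neqN1 := finField_sqr_neqN1 card_mod4.
have displD0 : {morph displ psi 0 : u v / u + v}.
  by move=> u v; rewrite displD; congr (_ + _); apply: displ_eq_dir.
pose phi : {additive 'cV[F]_4 -> 'cV[F]_4} := HB.pack (displ psi 0)
  (GRing.isZmodMorphism.Build _ _ (displ psi 0) (morphD_zmod_morphism displD0)).
have phi_null u : null u -> null (phi u) by apply: displ_null psi_null 0 u.
have phi_line u s : null u -> exists c, phi (s *: u) = c *: phi u.
  exact: (displ_scale sqr_neqN1 psi_null 0 0).
have [tau [k [k_neq0 phiZ mink_phi]]] := additive_null_preserver_semisimilarity
  sqr_neqN1 (finField_sqr_or_Nsqr card_mod4) phi_null phi_line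
  (dir_nonorthogonal sqr_neqN1 psi_null).
have [M Msim phiM] := semisimilarity_mulmx phiZ mink_phi.
exists tau, k, M; split=> // r; rewrite -phiM.
by rewrite /= /displ add0r subrK.
Qed.

Theorem theorem4p9 (F : finFieldType) (hq : (#|F| %% 4 = 3)%N)
    (psi : 'cV[F]_4 -> 'cV[F]_4) :
  (forall r1 r2 : 'cV[F]_4,
      mink (r1 - r2) (r1 - r2) = 0 -> r1 != r2 ->
      mink (psi r1 - psi r2) (psi r1 - psi r2) = 0 /\ psi r1 != psi r2)
  <->
  (exists (alpha : F) (r0 : 'cV[F]_4) (tau : {rmorphism F -> F})
          (M : 'M[F]_4),
      [/\ alpha != 0, bijective tau, lorentz M \/ antilorentz M &
          forall r, psi r = alpha *: (M *m map_mx tau r) + r0]).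
Proof.
split=> [psi_null|[alpha [r0 [tau [M [alpha_neq0 _ LM psiE]]]]] r1 r2].
  have [tau [k [M [k_neq0 Msim psiE]]]] :=
    null_preserving_similarity hq psi_null.
  have [s kE] := finField_sqr_or_Nsqr hq k.
  have s_neq0 : s != 0.
    apply: contra k_neq0 => /eqP s0.
    by case: kE => ->; rewrite s0 expr0n ?oppr0.
  exists s, (psi 0), tau, (s^-1 *: M); split=> //.
  - exact/injF_bij/fmorph_inj.
  - exact: similarity_lorentz_or_antilorentz kE Msim.
  - by move=> r; rewrite -scalemxAl scalerA divff // scale1r.
have [k k_neq0 Msim] := lorentz_or_antilorentz_similarity LM.
have two_neq0 := two_neq0_of_sqr_neqN1 (finField_sqr_neqN1 hq).
by rewrite !psiE; apply: similarity_null_preserving Msim r1 r2.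
Qed.
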